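(* Let $m,k\ge 1$ be integers, and let $N'_{m,k}(\alpha,\beta)=\sum_T\mathrm{wt}(T)$, summed over all Condensed Catalan tableaux $T$ of size $(k,k+m)$ whose shape $\lambda=(\lambda_1,\ldots,\lambda_k)$ satisfies $\lambda_1=m$ and $\lambda_k\ge 1$ (i.e. exactly $k$ nonzero rows and first row of length $m$). Then $$N'_{m,k}(\alpha,\beta)=\alpha^k\beta^m\sum_{\ell=0}^{k}\sum_{j=0}^{m}\alpha^j\beta^\ell\left(\binom{m+\ell-2+\delta_{jm}}{m-1}\binom{k+j-2+\delta_{\ell k}}{k-1}-\binom{m+\ell-2+\delta_{jm}}{m}\binom{k+j-2+\delta_{\ell k}}{k}\right),$$ where $\delta_{rs}$ is the Kronecker delta.
   Context: Binomial coefficients are $\binom{a}{b}=a(a-1)\cdots(a-b+1)/b!$ for integers $a$ and $b\ge 0$, and $\binom{a}{b}=0$ for $b<0$. For a partition $\lambda=(\lambda_1\ge\cdots\ge\lambda_k\ge 0)$ with $\lambda_1\le n-k$, the Young diagram (English convention) consists of boxes $(r,c)$, $1\le r\le k$, $1\le c\le\lambda_r$ (row 1 on top, column 1 leftmost), viewed inside a $k\times(n-k)$ rectangle. A Condensed Catalan tableau of size $(k,n)$ and shape $\lambda$ is an assignment to each box of one of $\alpha$, $\beta$, or empty, such that: (ii) if box $(r,c)$ contains $\beta$, every box $(r,c')$ with $c'<c$ is empty; (iii) if box $(r,c)$ contains $\alpha$, every box $(r',c)$ with $r'<r$ is empty; (iv) every box $(r,c)$ such that there is no $\alpha$ in any box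 $(r',c)$ with $r'>r$ and no $\beta$ in any box $(r,c')$ with $c'>c$ contains $\alpha$ or $\beta$. Its weight is $\mathrm{wt}(T)=\alpha^{k+a}\beta^{n-k+b}$, where $a$ and $b$ are the numbers of $\alpha$'s and $\beta$'s in the filling. *)

(* Defs.v *)
From HB Require Import structures.
From mathcomp Require Import all_boot all_order all_algebra.
Set Implicit Arguments. Unset Strict Implicit. Unset Printing Implicit Defensive.
Import Order.TTheory GRing.Theory Num.Theory.

Definition binz (R : numFieldType) (a : int) (b : nat) : R :=
  ((\prod_(i < b) (a - (i : nat)%:Z))%R)%:~R / (b`!)%:R.

(* Boxes of a k x w rectangle: (r, c) with row r : 'I_k (0 = top row) and
   column c : 'I_w (0 = leftmost column).  Contents: None = empty,
   Some true = alpha, Some false = beta. *)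
Definition filling (k w : nat) := {ffun 'I_k * 'I_w -> option bool}.

(* A shape: lam r = lambda_{r+1}, a partition inside the k x w rectangle. *)
Definition is_partition (k w : nat) (lam : {ffun 'I_k -> 'I_w.+1}) : bool :=
  [forall r1 : 'I_k, forall r2 : 'I_k, (r1 <= r2)%N ==> (lam r2 <= lam r1)%N].

Definition in_shape (k w : nat) (lam : {ffun 'I_k -> 'I_w.+1})
  (r : 'I_k) (c : 'I_w) : bool := (c < lam r)%N.

Definition isA (x : option bool) : bool := x == Some true.
Definition isB (x : option bool) : bool := x == Some false.

(* Condensed Catalan tableau of shape lam (boxes outside the shape are
   required to be empty, so that a tableau is exactly a filling of the
   Young diagram). *)
Definition is_cct (k w : nat) (lam : {ffun 'I_k -> 'I_w.+1}) (T : filling k w)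
  : bool :=
  [&& is_partition lam,
      [forall r : 'I_k, forall c : 'I_w, ~~ in_shape lam r c ==> (T (r, c) == None)],
      [forall r : 'I_k, forall c : 'I_w, (in_shape lam r c && isB (T (r, c))) ==>
          [forall c' : 'I_w, (c' < c)%N ==> (T (r, c') == None)]],
      [forall r : 'I_k, forall c : 'I_w, (in_shape lam r c && isA (T (r, c))) ==>
          [forall r' : 'I_k, (r' < r)%N ==> (T (r', c) == None)]] &
      [forall r : 'I_k, forall c : 'I_w, in_shape lam r c ==>
          (( ~~ [exists r' : 'I_k, [&& (r < r')%N, in_shape lam r' c & isA (T (r', c))]]
           && ~~ [exists c' : 'I_w, [&& (c < c')%N, in_shape lam r c' & isB (T (r, c'))]])
           ==> (T (r, c) != None))]].

Definition num_alpha (k w : nat) (T : filling k w) : nat :=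
  #|[set x | isA (T x)]|.
Definition num_beta (k w : nat) (T : filling k w) : nat :=
  #|[set x | isB (T x)]|.

(* wt(T) = alpha^(k+a) beta^(n-k+b), here with n - k = w. *)
Definition wt (R : numFieldType) (k w : nat) (al be : R) (T : filling k w) : R :=
  (al ^+ (k + num_alpha T) * be ^+ (w + num_beta T))%R.

Definition shapeN' (k w : nat) (lam : {ffun 'I_k -> 'I_w.+1}) : bool :=
  [forall r : 'I_k, ((r : nat) == 0%N) ==> ((lam r : nat) == w)] &&
  [forall r : 'I_k, ((r : nat) == k.-1) ==> (1 <= lam r)%N].

(* N'_{m,k}(alpha,beta): tableaux of size (k, k+m), i.e. width m. *)
Definition Nprime (R : numFieldType) (m k : nat) (al be : R) : R :=
  (\sum_(lam : {ffun 'I_k -> 'I_m.+1} | shapeN' lam)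
     \sum_(T : filling k m | is_cct lam T) wt al be T)%R.

Definition kdelta (r s : nat) : int := if r == s then 1%R else 0%R.

(* Main.v *)
Require Import Defs.
From HB Require Import structures.
From mathcomp Require Import all_boot all_order all_algebra.
From mathcomp Require Import ring zify.
Import Order.TTheory GRing.Theory Num.Theory.
Local Open Scope ring_scope.

(* A tableau is read column by column from right to left, and a row is dead once
   it contains a beta.  In a column of height p the live rows among the first p
   carry, from bottom to top, some betas, then one alpha, then blanks (or only
   betas).  So after any number of columns the only relevant data are the height
   p and the numbers a, b of alphas and betas: a new column of height p' >= p
   either kills all p' - b live rows, or adds one alpha and replaces b by any
   b' with b <= b' < p'.  The 2x2 determinants of binomial coefficients [ccoef]
   solve the resulting recurrence, by two applications of Pascal's rule. *)

(** * Binomial determinants and the recurrence they satisfy *)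

Section Binomials.

Set Implicit Arguments.
Unset Strict Implicit.

Variable R : numFieldType.
Implicit Types (a : int) (n b u q x y j l : nat).

Lemma binz0 a : binz R a 0 = 1.
Proof. by rewrite /binz big_ord0 fact0 divr1. Qed.

(** Both sides share the product of the [a - i] for [i < b]; what remains is
    [a + 1 = (b + 1) + (a - b)]. No sign condition on [a] enters, so the rule covers the upper index
    -1. *)
Lemma binz_pascal a b :
  binz R (a + 1) b.+1 = binz R a b + binz R a b.+1.
Proof.
rewrite /binz big_ord_recl big_ord_recr /= factS subr0.
rewrite (eq_bigr (fun i : 'I_b => a - (i : nat)%:Z)) => [|i _]; last first.
  by rewrite /bump /=; lia.
rewrite !rmorphM /= !rmorphD rmorphN /= natrM.
have fb : (b`!)%:R != 0 :> R by rewrite pnatr_eq0 -lt0n fact_gt0.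
have : b.+1%:R != 0 :> R by rewrite pnatr_eq0.
rewrite -natr1 -[(b : int)%:~R]/(b%:R) => Sb.
by field; rewrite -[X in X + _]mul1r -mulrDl mulf_neq0 // addrC.
Qed.

Lemma binz_nat n b : binz R n b = 'C(n, b)%:R.
Proof.
elim: n b => [|n IHn] [|b]; rewrite ?binz0 ?bin0 //.
  by rewrite /binz big_ord_recl /= subr0 !mul0r.
by rewrite intS addrC binz_pascal !IHn binS natrD addrC.
Qed.

(* The shift by one keeps the upper index [n] a natural number; [n = 0] gives
   the value (-1)^b. *)
Definition pbin n b : R := binz R (n%:Z - 1) b.

Lemma pbin0 n : pbin n 0 = 1.
Proof. exact: binz0. Qed.

Lemma pbin_pascal n b : pbin n.+1 b.+1 = pbin n b + pbin n b.+1.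
Proof. by rewrite /pbin -binz_pascal; congr binz; lia. Qed.

Lemma pbinS n b : pbin n.+1 b = 'C(n, b)%:R.
Proof. by rewrite /pbin -binz_nat; congr binz; lia. Qed.

Lemma pbin01 : pbin 0 1 = -1.
Proof. by rewrite /pbin /binz big_ord1 divr1 subr0 rmorphN1. Qed.

Lemma pbin_small n b : (n < b)%N -> pbin n.+1 b = 0.
Proof. by move=> lt_nb; rewrite pbinS bin_small. Qed.

Definition bdet u q x y : R :=
  pbin x u * pbin y q - pbin x u.+1 * pbin y q.+1.

Lemma bdet0l u q x y : (x < u)%N -> bdet u q x.+1 y = 0.
Proof.
by move=> lt_xu; rewrite /bdet !pbin_small ?mul0r ?subr0 // ltnW.
Qed.

Lemma bdet0r u q x y : (y < q)%N -> bdet u q x y.+1 = 0.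
Proof.
by move=> lt_yq; rewrite /bdet !(@pbin_small y _) ?mulr0 ?subr0 // ltnW.
Qed.

(** The determinant is linear in the pair of factors with upper index [x], so Pascal's rule passes
    to it. Read as a difference in [x], the identity telescopes sums over the number of betas;
    [bdetSr] does the same for heights. *)
Lemma bdetSl u q x y : bdet u.+1 q x.+1 y = bdet u q x y + bdet u.+1 q x y.
Proof. by rewrite /bdet !pbin_pascal; ring. Qed.

Lemma bdetSr u q x y : bdet u q.+1 x y.+1 = bdet u q x y + bdet u q.+1 x y.
Proof. by rewrite /bdet !pbin_pascal; ring. Qed.

(* Number of tableaux with [u.+1] columns, first row full, [q.+1] nonempty rows,
   [j] alphas and [l] betas. *)
Definition ccoef u q j l : R :=
  bdet u q (u + l + (j == u.+1)) (q + j + (l == q.+1)).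

(** Symmetry of the binomials of upper index [(u + q).+1]. Combinatorially, an alpha in the leftmost
    column lies in a row without beta, so not every column has an alpha and every row a beta. *)
Lemma ccoef_diag u q : ccoef u q u.+1 q.+1 = 0.
Proof.
rewrite /ccoef !eqxx !addn1 !addnS /bdet !pbinS.
rewrite -(bin_sub (n := (u + q).+1) (m := u)); last by lia.
rewrite -(bin_sub (n := (u + q).+1) (m := u.+1)); last by lia.
have -> : ((u + q).+1 - u = q.+1)%N by lia.
have -> : ((u + q).+1 - u.+1 = q)%N by lia.
by rewrite (addnC q u) mulrC subrr.
Qed.

(** Without alphas every nonempty row must contain a beta. In the formula the case [q = 0] rests on
    the value -1 of [pbin 0 1]. *)
Lemma ccoef_j0 u q l : (l <= q)%N -> ccoef u q 0 l = 0.
Proof.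
move=> le_lq; rewrite /ccoef /= !addn0 (_ : l == q.+1 = false) ?addn0; last lia.
case: q le_lq => [|q] le_lq; last by rewrite bdet0r.
move: le_lq; rewrite leqn0 => /eqP->; rewrite addn0 /bdet pbin0.
by rewrite pbin01 mulr1 mulrN1 opprK -pbin_pascal pbin_small.
Qed.

Lemma sum_ccoef_row u q j l : (j <= u.+1)%N -> (l <= q)%N ->
  \sum_(l0 < l.+1) ccoef u q j l0 =
    bdet u.+1 q (u.+1 + l + (j == u.+1)) (q + j).
Proof.
move=> le_ju; elim: l => [|l IHl] le_lq.
  rewrite big_ord1 /ccoef /= !addn0 addSn bdetSl -[LHS]addr0; congr (_ + _).
  (* The lower end of the telescoping sum vanishes. Only [u = 0], [j = 0] escapes [bdet0l]; there it
     is the opposite of [pbin q.+1 q.+1], which is 0. *)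
  apply/esym; case: eqP => [_|neq_ju]; first by rewrite addn1 bdet0l.
  rewrite addn0; case: u le_ju neq_ju => [|u] le_ju neq_ju; last first.
    by rewrite bdet0l.
  have -> : j = 0%N by lia.
  have := pbin_pascal q q; rewrite (@pbin_small q _) // /bdet addn0 => pbin_q.
  have pbin02 : pbin 0 2 = 1.
    by have := pbin_pascal 0 1; rewrite (@pbin_small 0 _) // pbin01 => /eqP;
      rewrite eq_sym addrC addr_eq0 opprK => /eqP.
  by rewrite pbin01 pbin02 mulN1r mul1r -opprD -pbin_q oppr0.
rewrite big_ord_recr /= IHl ?(ltnW le_lq) //.
rewrite /ccoef (_ : l.+1 == q.+1 = false) ?addn0; last by lia.
by rewrite !addnS !addSn [RHS]bdetSl addrC.
Qed.

(** The sum runs over the possible predecessors, with [j] alphas, of a tableau of height [q.+1] with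
    [l] betas. The inner sums are telescoped by [sum_ccoef_row]; the sum over heights telescopes in
    turn by [bdetSr]. *)
Lemma sum_ccoef u q j l : (j <= u.+1)%N -> (l <= q.+1)%N ->
  \sum_(q0 < q.+1) \sum_(l0 < q0.+2 | (l0 <= l)%N) ccoef u q0 j l0 =
    bdet u.+1 q (u.+1 + l + (j == u.+1)) (q + j).+1.
Proof.
move=> le_ju.
pose Q q l : R := \sum_(q0 < q.+1) \sum_(l0 < q0.+2 | (l0 <= l)%N)
  ccoef u q0 j l0.
have rowE q1 l1 : (l1 <= q1)%N ->
    \sum_(l0 < q1.+2 | (l0 <= l1)%N) ccoef u q1 j l0 =
      bdet u.+1 q1 (u.+1 + l1 + (j == u.+1)) (q1 + j).
  move=> le_lq; rewrite -(sum_ccoef_row le_ju le_lq).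
  rewrite (big_ord_widen q1.+2 (fun i => ccoef u q1 j i)); last by lia.
  by apply: eq_bigl => i; rewrite ltnS.
(* Smaller heights allow at most [q1] betas, so raising the bound to [q1.+1] adds a single term. *)
have full q1 : Q q1 q1.+1 = Q q1 q1 + ccoef u q1 j q1.+1.
  rewrite /Q !big_ord_recr /= -addrA; congr (_ + _).
    apply: eq_bigr => q0 _; apply: eq_bigl => l0.
    by have := ltn_ord q0; have := ltn_ord l0; lia.
  rewrite big_mkcond [in RHS]big_mkcond big_ord_recr [in RHS]big_ord_recr /=.
  rewrite leqnn ltnn addr0; congr (_ + _); apply: eq_bigr => l0 _.
  by have := ltn_ord l0; rewrite ltnS => le_l0; rewrite le_l0 (leqW le_l0).
(* The shift [l == q.+1] in [ccoef] gives the added term the right index [(q1 + j).+1] of the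
   partial sum, so that [bdetSl] applies. *)
have diag q1 : Q q1 q1 = bdet u.+1 q1 (u.+1 + q1 + (j == u.+1)) (q1 + j).+1 ->
    Q q1 q1.+1 = bdet u.+1 q1 (u.+1 + q1.+1 + (j == u.+1)) (q1 + j).+1.
  move=> Qdiag; rewrite full Qdiag /ccoef eqxx !addn1.
  by rewrite !addnS !addSn [RHS]bdetSl addrC.
rewrite -/(Q q l); elim: q l => [|q IHq] l; rewrite leq_eqVlt ltnS.
  have Q0 : Q 0 0 = bdet u.+1 0 (u.+1 + 0 + (j == u.+1)) (0 + j).+1.
    rewrite /Q big_ord1 rowE // /bdet !pbin0 add0n pbin_pascal pbin0 addn0.
    by case: eqP => _; rewrite ?addn1 ?addn0 (@pbin_small _ u.+2) // !mul0r.
  by case/predU1P => [-> | ]; [exact: diag | rewrite leqn0 => /eqP->].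
have step l1 : (l1 <= q.+1)%N ->
    Q q.+1 l1 = bdet u.+1 q.+1 (u.+1 + l1 + (j == u.+1)) (q.+1 + j).+1.
  move=> le_lq; rewrite /Q big_ord_recr /= -/(Q q l1) IHq // rowE //.
  by rewrite !addSn [RHS]bdetSr.
by case/predU1P => [-> | /step]; [exact/diag/step | ].
Qed.

(** Pairing the coefficients with an arbitrary test function [g] records the three statistics at
    once and turns the addition of a column into an operator on [g]. *)
Definition ccoef_sum u k (g : nat -> nat -> nat -> R) : R :=
  \sum_(q < k) \sum_(j < u.+2) \sum_(l < q.+2) ccoef u q j l * g q.+1 j l.

(* The sum of [g height #alpha #beta] over the ways to add a leftmost column to a
   tableau of height [p] with [a] alphas and [b] betas; the new height is
   [q.+1], and the last summand is the column without alpha. *)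
Definition column_step k (g : nat -> nat -> nat -> R) (p a b : nat) : R :=
  \sum_(q < k | (p <= q.+1)%N)
     (\sum_(b' < q.+1 | (b <= b')%N) g q.+1 a.+1 b' + g q.+1 a q.+1).

(** Exchanging the sums moves the operator from [g] to the coefficients: each value of [g] is then
    weighted by a partial sum [S], which [sum_ccoef] evaluates. *)
Lemma ccoef_sum_step u k g :
  ccoef_sum u k (column_step k g) = ccoef_sum u.+1 k g.
Proof.
pose S q j l := \sum_(q0 < q.+1) \sum_(l0 < q0.+2 | (l0 <= l)%N)
  ccoef u q0 j l0.
transitivity (\sum_(q < k) \sum_(j < u.+2)
  (\sum_(l < q.+1) S q j l * g q.+1 j.+1 l + S q j q.+1 * g q.+1 j q.+1)).
  rewrite /ccoef_sum exchange_big /= [RHS]exchange_big /=.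
  apply: eq_bigr => j _.
  under eq_bigr => q0 _.
    under eq_bigr => l0 _ do rewrite /column_step mulr_sumr.
    rewrite exchange_big /=.
    over.
  rewrite (exchange_big_dep xpredT) //=; apply: eq_bigr => q _.
  transitivity (\sum_(q0 < q.+1) \sum_(l0 < q0.+2)
    ccoef u q0 j l0 * (\sum_(b' < q.+1 | (l0 <= b')%N) g q.+1 j.+1 b'
      + g q.+1 j q.+1)).
    by rewrite (big_ord_widen k (fun q0 : nat => \sum_(l0 < q0.+2)
      ccoef u q0 j l0 * (\sum_(b' < q.+1 | (l0 <= b')%N) g q.+1 j.+1 b'
      + g q.+1 j q.+1))).
  under [LHS]eq_bigr => q0 _.
    under eq_bigr => l0 _ do rewrite mulrDr.
    rewrite big_split /=.
    over.
  rewrite big_split /=; congr (_ + _); last first.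
    rewrite /S mulr_suml; apply: eq_bigr => q0 _; rewrite mulr_suml.
    by apply: eq_bigl => l0; have := ltn_ord q0; have := ltn_ord l0; lia.
  under [RHS]eq_bigr => l _ do rewrite mulr_suml.
  rewrite [RHS]exchange_big /=; apply: eq_bigr => q0 _.
  under [RHS]eq_bigr => l _ do rewrite mulr_suml.
  under eq_bigr => l _ do rewrite mulr_sumr.
  by rewrite (exchange_big_dep xpredT).
(* Coefficients are compared separately for [l <= q], where the new column has an alpha, and for
   [l = q.+1], where it has none. *)
apply: eq_bigr => q _; rewrite big_split /=.
under [RHS]eq_bigr => j _ do rewrite big_ord_recr /=.
rewrite [RHS]big_split /=; congr (_ + _).
  rewrite [RHS]big_ord_recl [X in _ = X + _]big1 ?add0r; last first.
    by move=> l _; rewrite ccoef_j0 ?mul0r // -ltnS.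
  apply: eq_bigr => j _; apply: eq_bigr => l _; congr (_ * _).
  rewrite /S sum_ccoef /ccoef; try by have := ltn_ord l; have := ltn_ord j; lia.
  by rewrite /= (_ : (l : nat) == q.+1 = false) ?addn0 ?addnS //;
    have := ltn_ord l; lia.
rewrite [RHS]big_ord_recr /= ccoef_diag mul0r addr0.
apply: eq_bigr => j _; congr (_ * _).
have le_ju : (j <= u.+1)%N by rewrite -ltnS.
(* At [j = u.+1] the partial sum carries a shift that [ccoef u.+1] lacks; by [bdetSl] the
   discrepancy is the null term of [ccoef_diag]. *)
rewrite /S; have [->|neq_ju] := eqVneq (j : nat) u.+1; last first.
  rewrite sum_ccoef // /ccoef eqxx (negPf neq_ju) addn1.
  by rewrite (_ : (j : nat) == u.+2 = false) //; lia.
rewrite sum_ccoef // /ccoef !eqxx (_ : u.+1 == u.+2 = false); last by lia.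
rewrite addn0 !addn1 [in LHS]addSn bdetSl -[RHS]add0r; congr (_ + _).
by rewrite -(ccoef_diag u q) /ccoef !eqxx !addn1 !addnS.
Qed.

Lemma column_step0 k g : column_step k g 0 0 0 = ccoef_sum 0 k g.
Proof.
rewrite /column_step /ccoef_sum; apply: eq_bigr => q _.
rewrite [RHS]big_ord_recl big_ord1 /=.
rewrite [X in _ = X + _]big_ord_recr [X in _ = _ + X]big_ord_recr /=.
rewrite ccoef_diag mul0r addr0 [X in _ = X + _ + _]big1 ?add0r; last first.
  by move=> l _; rewrite ccoef_j0 ?mul0r // -ltnS.
rewrite addrC; congr (_ + _).
  rewrite /ccoef eqxx /= !addn0 add0n addn1 /bdet !pbin0 pbinS binn mul1r.
  by rewrite (@pbin_small q q.+1) // mulr0 subr0 mul1r.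
apply: eq_big => // l _.
rewrite /ccoef /= (_ : (l : nat) == q.+1 = false); last first.
  by have := ltn_ord l; lia.
rewrite add0n addn0 !addn1 /bdet pbin0 pbinS binn (@pbin_small q q.+1) //.
by rewrite mulr0 subr0 !mul1r.
Qed.

End Binomials.

(** * Initial segments and ranks in ordinals *)

Lemma card_ord_lt {k n : nat} : (n <= k)%N -> #|[set i : 'I_k | (i < n)%N]| = n.
Proof.
move=> le_nk; rewrite -sum1dep_card (big_ord_narrow le_nk).
by rewrite sum1_card card_ord.
Qed.

(** If [A] contains [i] it contains the segment up to [i]; otherwise it lies strictly below [i].
    Comparing sizes gives both directions. *)
Lemma down_closed_card {k : nat} {A : {set 'I_k}} :
  (forall i j : 'I_k, (i <= j)%N -> j \in A -> i \in A) ->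
  forall i : 'I_k, (i \in A) = (i < #|A|)%N.
Proof.
move=> downA i; apply/idP/idP => [iA | ].
  rewrite -[X in (X <= _)%N](card_ord_lt (ltn_ord i)).
  by apply/subset_leq_card/subsetP => j; rewrite inE ltnS => /downA; apply.
apply: contraLR => iNA; rewrite -leqNgt -[leqRHS](card_ord_lt (ltnW (ltn_ord i))).
apply/subset_leq_card/subsetP => j jA; rewrite inE ltnNge.
by apply: contra iNA => /downA; apply.
Qed.

(** The least element of [D] has all the others above it, and removing it changes no other count, so
    each value below [#|D|] is taken once. For live rows [D], the count is the number of betas under
    an alpha. *)
Lemma sum_card_above {V : nmodType} {k : nat} (D : {set 'I_k}) (f : nat -> V) :
  \sum_(r in D) f #|[set i in D | (r < i)%N]| = \sum_(i < #|D|) f i.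
Proof.
move: {2}#|D| (erefl #|D|) => d; elim: d D => [|d IHd] D cardD.
  by rewrite cardD big_ord0 (cards0_eq cardD) big_set0.
have [r0 r0D] : exists r, r \in D by apply/card_gt0P; rewrite cardD.
case: (arg_minnP (fun i : 'I_k => i : nat) r0D) => r rD r_min.
have {}rD : r \in D by [].
have cardDr : #|D :\ r| = d by have := cardsD1 r D; rewrite cardD rD => -[].
rewrite cardD big_ord_recr /= (big_setD1 r) //= addrC; congr (_ + f _).
  have := IHd _ cardDr; rewrite cardDr => <-.
  apply: eq_bigr => s /setD1P[neq_sr sD]; congr f; apply: eq_card => i.
  rewrite !inE; case: eqP => [->|_ //]; rewrite rD /=.
  by apply/negbTE; rewrite -leqNgt r_min.
rewrite -cardDr; apply: eq_card => i; rewrite !inE andbC.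
case iD: (i \in D); rewrite ?andbF ?andbT //.
by rewrite ltn_neqAle r_min // andbT eq_sym.
Qed.

(** * Tableaux and their leftmost columns *)

Section Tableaux.

Set Implicit Arguments.
Unset Strict Implicit.

Variable n : nat.
Local Notation k := n.+1.
Local Notation shape w := {ffun 'I_k -> 'I_w.+1}.
Implicit Types (w : nat) (q r : 'I_k).

Definition cct_spec w (lam : shape w) (T : filling k w) : Prop :=
  [/\ forall r1 r2, (r1 <= r2)%N -> (lam r2 <= lam r1)%N,
      forall r (c : 'I_w), (lam r <= c)%N -> T (r, c) = None,
      forall r (c c' : 'I_w),
        T (r, c) = Some false -> (c' < c)%N -> T (r, c') = None,
      forall r r' (c : 'I_w),
        T (r, c) = Some true -> (r' < r)%N -> T (r', c) = None &
      forall r (c : 'I_w), (c < lam r)%N ->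
        (forall r' : 'I_k, (r < r')%N -> T (r', c) <> Some true) ->
        (forall c' : 'I_w, (c < c')%N -> T (r, c') <> Some false) ->
        T (r, c) <> None].

(** Boxes outside the shape are empty, so a box holding a letter is in the shape; this supplies the
    [in_shape] guards of [is_cct]. *)
Lemma cctP w (lam : shape w) (T : filling k w) :
  reflect (cct_spec lam T) (is_cct lam T).
Proof.
apply: (iffP and5P); rewrite /in_shape /isA /isB.
  case=> /forallP part /forallP out /forallP beta /forallP alpha /forallP cover.
  have shapeT r (c : 'I_w) : T (r, c) <> None -> (c < lam r)%N.
    move=> T_rc; have /forallP/(_ c) := out r.
    by case: (c < lam r)%N => //= /eqP.
  split.
  - by move=> r1 r2; have /forallP/(_ r2)/implyP := part r1.
  - move=> r c le_c; have /forallP/(_ c)/implyP := out r.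
    by rewrite -leqNgt => /(_ le_c)/eqP.
  - move=> r c c' T_rc; have /forallP/(_ c)/implyP := beta r.
    rewrite shapeT T_rc //= => /(_ isT)/forallP/(_ c')/implyP H lt_c.
    exact/eqP/H.
  - move=> r r' c T_rc; have /forallP/(_ c)/implyP := alpha r.
    rewrite shapeT T_rc //= => /(_ isT)/forallP/(_ r')/implyP H lt_c.
    exact/eqP/H.
  - move=> r c lt_c noA noB; have /forallP/(_ c)/implyP/(_ lt_c) := cover r.
    move=> /implyP H; apply/eqP/H/andP; split; apply/existsPn.
      by move=> r'; apply/and3P => -[/noA nA _ /eqP].
    by move=> c'; apply/and3P => -[/noB nB _ /eqP].
case=> part out beta alpha cover; split.
- by do 2!apply/forallP => ?; apply/implyP/part.
- by do 2!apply/forallP => ?; apply/implyP; rewrite -leqNgt => /out->.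
- apply/forallP => r; apply/forallP => c; apply/implyP => /andP[_ /eqP T_rc].
  by apply/forallP => c'; apply/implyP => /(beta _ _ _ T_rc)->.
- apply/forallP => r; apply/forallP => c; apply/implyP => /andP[_ /eqP T_rc].
  by apply/forallP => r'; apply/implyP => /(alpha _ _ _ T_rc)->.
apply/forallP => r; apply/forallP => c; apply/implyP => lt_c.
have shapeT r1 (c1 : 'I_w) : T (r1, c1) <> None -> (c1 < lam r1)%N.
  by move=> T_rc; rewrite ltnNge; apply/negP => /out.
apply/implyP => /andP[/existsPn noA /existsPn noB]; apply/eqP/cover => //.
  move=> r' lt_r T_rc; have := noA r'.
  by rewrite lt_r T_rc eqxx shapeT ?T_rc.
move=> c' lt_c' T_rc; have := noB c'.
by rewrite lt_c' T_rc eqxx shapeT ?T_rc.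
Qed.

Definition height w (lam : shape w) : nat := #|[set r : 'I_k | (0 < lam r)%N]|.

Lemma height_le w (lam : shape w) : (height lam <= k)%N.
Proof. by rewrite -[leqRHS](card_ord k) max_card. Qed.

Lemma lt_height w (lam : shape w) r :
  (forall r1 r2, (r1 <= r2)%N -> (lam r2 <= lam r1)%N) ->
  (r < height lam)%N = (0 < lam r)%N.
Proof.
move=> part; rewrite -down_closed_card ?inE // => i j /part le_ij.
by rewrite !inE => /leq_trans; apply.
Qed.

Definition top_full w (lam : shape w) : bool :=
  [forall r : 'I_k, ((r : nat) == 0%N) ==> ((lam r : nat) == w)].

(** Bottom rows may be empty: unlike the condition that all rows be nonempty, this class is stable
    under deletion of the leftmost column. *)
Definition full_cct w (x : shape w * filling k w) : bool :=
  top_full x.1 && is_cct x.1 x.2.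

(** The bound [q] is the last row of the column to be added, so rows that are still empty but will
    be reached count as live. *)
Definition live w q (T : filling k w) : {set 'I_k} :=
  [set r : 'I_k | (r <= q)%N & [forall c : 'I_w, T (r, c) != Some false]].

Definition in_column (D : {set 'I_k}) (a : option 'I_k) : bool :=
  if a is Some r then r \in D else true.

(* The column whose alpha is in row [a] (no alpha if [a = None]), where [D] is
   the set of rows not yet closed by a beta. *)
Definition new_column (D : {set 'I_k}) (a : option 'I_k) r : option bool :=
  if r \in D then
    if a is Some s then
      if (r < s)%N then None else Some (r == s)
    else Some false
  else None.

Definition add_column w (y : shape w * filling k w * ('I_k * option 'I_k)) :
    shape w.+1 * filling k w.+1 :=
  let: (lam, T, (q, a)) := y in
  ([ffun r : 'I_k => if (r <= q)%N then lift ord0 (lam r) else ord0],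
   [ffun x : 'I_k * 'I_w.+1 => if unlift ord0 x.2 is Some c then T (x.1, c)
              else new_column (live q T) a x.1]).

(** Both [inord] stay in range. A full tableau of width [w.+1] has a nonempty first row, so its
    positive height is recovered from the predecessor. *)
Definition del_column w (x : shape w.+1 * filling k w.+1) :
    shape w * filling k w * ('I_k * option 'I_k) :=
  (([ffun r : 'I_k => inord (x.1 r).-1],
    [ffun y : 'I_k * 'I_w => x.2 (y.1, lift ord0 y.2)]),
   (inord (height x.1).-1, [pick r : 'I_k | x.2 (r, ord0) == Some true])).

Definition addable w (y : shape w * filling k w * ('I_k * option 'I_k)) : bool :=
  let: (x, (q, a)) := y in
  [&& full_cct x, (height x.1 <= q.+1)%N &
      in_column (live q x.2) a].

(** The leftmost column is determined by its height and its alpha: rows with a beta are blank by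
    (ii), rows above the alpha by (iii), and (iv) forces a letter in each live row below it, which
    must be a beta. *)
Lemma del_columnP w (x : shape w.+1 * filling k w.+1) : full_cct x ->
  addable (del_column x) /\ add_column (del_column x) = x.
Proof.
case: x => lam T; rewrite /full_cct /del_column /=.
set lam' := finfun _; set T' := finfun _; set q := inord _.
case/andP => /forallP top /cctP[part out beta alpha cover].
have lam'E r : lam' r = (lam r).-1 :> nat.
  by rewrite ffunE inordK //; have := ltn_ord (lam r); lia.
have T'E r c : T' (r, c) = T (r, lift ord0 c) by rewrite ffunE.
have ht_gt0 : (0 < height lam)%N.
  by rewrite (lt_height ord0 part); have /eqP -> := top ord0.
have qE : q.+1 = height lam.
  by rewrite inordK prednK //; exact: height_le.
have le_q r : (r <= q)%N = (0 < lam r)%N by rewrite -lt_height // -qE ltnS.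
have liveP r : reflect (0 < lam r /\ forall c, T (r, lift ord0 c) <> Some false)%N
    (r \in live q T').
  rewrite inE le_q; apply: (iffP andP) => -[-> noB]; split=> //.
    by move=> c; have /forallP/(_ c)/eqP := noB; rewrite T'E.
  by apply/forallP => c; rewrite T'E; apply/eqP.
have lt0_lift (c : 'I_w) : (0 < lift ord0 c)%N by rewrite lift0.
have pick_live r : T (r, ord0) = Some true -> r \in live q T'.
  move=> T_r0; apply/liveP; split.
    rewrite lt0n; apply/eqP => lam0; have := out r ord0.
    by rewrite lam0 T_r0 => /(_ isT).
  by move=> c /beta B; have := B ord0 (lt0_lift c); rewrite T_r0.
split.
  rewrite /addable /full_cct /=; apply/and3P; split; last first.
  - by case: pickP => // r /eqP/pick_live.
  - rewrite qE; apply/subset_leq_card/subsetP => r.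
    by rewrite !inE lam'E; lia.
  apply/andP; split.
    by apply/forallP => r; apply/implyP => r0; rewrite lam'E;
      have /implyP/(_ r0)/eqP-> := top r.
  apply/cctP; split.
  - by move=> r1 r2 /part; rewrite !lam'E; lia.
  - by move=> r c; rewrite lam'E T'E => le_c; apply: out; rewrite lift0; lia.
  - move=> r c c'; rewrite !T'E => /beta B lt_c; apply: B.
    by rewrite !lift0.
  - by move=> r r' c; rewrite !T'E; apply: alpha.
  - move=> r c; rewrite lam'E !T'E => lt_c noA noB; apply: cover.
    + by rewrite lift0; lia.
    + by move=> r' /noA; rewrite T'E.
    move=> c'; case: (unliftP ord0 c') => [c1 ->|-> //].
    by rewrite !lift0 ltnS => /noB; rewrite T'E.
congr pair; apply/ffunP.
  move=> r; apply: val_inj; rewrite ffunE le_q.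
  case: posnP => [/= -> //|lam_gt0].
  by transitivity (lam' r).+1; [exact: lift0 | rewrite lam'E prednK].
case=> r c; rewrite ffunE /=; case: unliftP => [c' -> | ->]; first exact: T'E.
rewrite /new_column; case: liveP => [[lam_gt0 noB]|]; last first.
  move=> not_live; case lam0: (lam r == ord0).
    by rewrite out // (eqP lam0).
  case: (pickP (fun c => T (r, lift ord0 c) == Some false)) => [c' /eqP | noB].
    by move=> /beta B; rewrite B.
  case: not_live; split=> [|c']; last by apply/eqP; rewrite noB.
  by rewrite lt0n -(inj_eq val_inj) in lam0 *; rewrite lam0.
(* In a live row no beta lies to the right, so (iv) only depends on the alphas below. *)
have cover0 : (forall r' : 'I_k, (r < r')%N -> T (r', ord0) <> Some true) ->
    T (r, ord0) <> None.
  move=> noA; apply: cover => // c'.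
  by case: (unliftP ord0 c') => [c1 -> _|-> //]; apply: noB.
case: pickP => [s /eqP T_s | noA].
  have [lt_rs|lt_sr|/val_inj ->] := ltngtP r s.
  - by rewrite (alpha _ _ _ T_s).
  - have neq_rs : r == s = false.
      by apply/eqP => eq_rs; rewrite eq_rs ltnn in lt_sr.
    have noA (r' : 'I_k) : (s < r')%N -> T (r', ord0) <> Some true.
      by move=> lt_sr' /alpha/(_ lt_sr'); rewrite T_s.
    rewrite neq_rs; have := noA r lt_sr.
    have := cover0 (fun r' lt_rr' => noA r' (ltn_trans lt_sr lt_rr')).
    by case: (T _) => [[]|].
  - by rewrite eqxx.
have := cover0 (fun r' _ => elimF eqP (noA r')).
by have := noA r; case: (T _) => [[]|].
Qed.

(** Rule (iv) looks only right and down, so old boxes are unaffected by a column added on the left.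
    In the new column, the only blanks in live rows are above the alpha, where (iv) demands
    nothing. *)
Lemma add_columnP w (y : shape w * filling k w * ('I_k * option 'I_k)) :
  addable y ->
  [/\ full_cct (add_column y), del_column (add_column y) = y &
      height (add_column y).1 = y.2.1.+1].
Proof.
case: y => -[lam' T'] [q a]; rewrite /addable /full_cct /=.
set D := live _ _; set lam := finfun _; set T := finfun _.
case/and3P => /andP[/forallP top /cctP[part out beta alpha cover]] le_hq aD.
have lamE r : lam r = (if (r <= q)%N then (lam' r).+1 else 0%N) :> nat.
  by rewrite ffunE; case: ifP => _; rewrite ?lift0.
have lam'0 r : (q < r)%N -> lam' r = 0%N :> nat.
  move=> lt_qr; apply/eqP; rewrite -leqn0 leqNgt -lt_height // -leqNgt.
  exact: leq_trans lt_qr.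
have TS r c : T (r, lift ord0 c) = T' (r, c) by rewrite ffunE liftK.
have T0 r : T (r, ord0) = new_column D a r by rewrite ffunE unlift_none.
have liveP r : reflect (r <= q /\ forall c, T' (r, c) <> Some false)%N (r \in D).
  rewrite inE; apply: (iffP andP) => -[-> noB]; split=> //.
    by move=> c; have /forallP/(_ c)/eqP := noB.
  by apply/forallP => c; apply/eqP.
have colA r : new_column D a r = Some true -> a = Some r.
  rewrite /new_column; case: (_ \in _) => //; case: a {aD T T0 TS} => // s.
  by case: ifP => // _ [/eqP->].
have colA' s : a = Some s -> new_column D a s = Some true.
  by move=> aE; rewrite /new_column; rewrite aE /= in aD *; rewrite aD ltnn eqxx.
have htE : height lam = q.+1.
  rewrite -[RHS](card_ord_lt (ltn_ord q)); apply: eq_card => r.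
  by rewrite !inE lamE ltnS; case: ifP.
split=> //.
  apply/andP; split.
    apply/forallP => r; apply/implyP => /eqP r0; rewrite lamE r0 /=.
    by rewrite eqSS; have /implyP := top r; apply; apply/eqP.
  apply/cctP; split.
  - move=> r1 r2 le_r; rewrite !lamE; have := part _ _ le_r.
    by case: ifP; case: ifP => //; lia.
  - move=> r c; rewrite lamE; case: (unliftP ord0 c) => [c' ->|->].
      rewrite lift0 TS => le_c; apply: out.
      by case: (leqP r q) le_c => // /lam'0->.
    case: (leqP r q) => // lt_qr _; rewrite T0 /new_column.
    by case: liveP => // -[]; rewrite leqNgt lt_qr.
  - move=> r c c'; case: (unliftP ord0 c) => [c1 ->|-> //].
    rewrite TS => Bc1; case: (unliftP ord0 c') => [c2 ->|-> _].
      by rewrite !lift0 TS ltnS; apply: beta Bc1.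
    by rewrite T0 /new_column; case: liveP => // -[_ /(_ c1)].
  - move=> r r' c; case: (unliftP ord0 c) => [c1 ->|->].
      by rewrite !TS; apply: alpha.
    rewrite !T0 => /colA aE lt_r; rewrite /new_column aE lt_r.
    by case: ifP.
  - move=> r c; rewrite lamE; case: (unliftP ord0 c) => [c1 ->|->].
      rewrite lift0 TS; case: ifP => // _; rewrite ltnS => lt_c noA noB.
      apply: cover => // [r' /noA|c' lt_c']; first by rewrite TS.
      by rewrite -TS; apply: noB; rewrite !lift0.
    case: (leqP r q) => // le_rq _ noA noB.
    have rD : r \in D.
      by apply/liveP; split=> // c1; rewrite -TS; apply: noB; rewrite lift0.
    rewrite T0 /new_column rD; case aE: a => [s|//].
    case: ltnP => // /noA; rewrite T0; case; exact: colA'.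
rewrite /del_column /=; congr (_, _, (_, _)).
- apply/ffunP => r; apply: ord_inj; rewrite ffunE inordK ?lamE.
    by case: (leqP r q) => // /lam'0->.
  by case: ifP => _ //=; apply: ltn_ord.
- by apply/ffunP => -[r c]; rewrite ffunE TS.
- by rewrite htE inord_val.
case: pickP => [r | noA]; first by rewrite T0 => /eqP/colA.
by case aE: a => [s|//]; have := noA s; rewrite T0 colA'.
Qed.

(** * Letter counts after adding a column *)

Lemma card_add_column w (T : filling k w.+1) (P : pred (option bool)) :
  #|[set x | P (T x)]| =
  (#|[set r : 'I_k | P (T (r, ord0))]| +
   #|[set x : 'I_k * 'I_w | P (T (x.1, lift ord0 x.2))]|)%N.
Proof.
have cardE (I : finType) (Q : pred I) : #|[set x | Q x]| = (\sum_x Q x)%N.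
  by rewrite -sum1dep_card big_mkcond.
rewrite !cardE -(pair_bigA _ (fun r (c : 'I_w) => P (T (r, lift ord0 c)) : nat)).
rewrite (eq_bigr (fun x => P (T (x.1, x.2)) : nat)) => [|[]//].
rewrite -(pair_bigA _ (fun r c => P (T (r, c)) : nat)) /=.
by rewrite -big_split /=; apply: eq_bigr => r _; rewrite big_ord_recl.
Qed.

(** By (ii) a row has at most one beta, so projection to rows matches the betas with the dead rows;
    the height bound keeps these among the first [q.+1]. *)
Lemma card_live w (lam : shape w) (T : filling k w) q :
  is_cct lam T -> (height lam <= q.+1)%N ->
  (#|live q T| + num_beta T)%N = q.+1.
Proof.
case/cctP=> part out beta _ _ le_hq.
have fst_inj : {in [set x | isB (T x)] &, injective fst}.
  move=> [r c] [r' c']; rewrite !inE /= => /eqP Trc /eqP Trc' eq_r.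
  rewrite -{}eq_r in Trc' *; congr (_, _); apply: val_inj.
  case: (ltngtP c c') => // lt_c.
    by rewrite (beta _ _ _ Trc' lt_c) in Trc.
  by rewrite (beta _ _ _ Trc lt_c) in Trc'.
rewrite /num_beta -(card_in_imset fst_inj) -[RHS](card_ord_lt (ltn_ord q)).
rewrite -(cardsID (live q T) [set i : 'I_k | (i < q.+1)%N]); congr (_ + _)%N.
  by apply: eq_card => r; rewrite !inE ltnS; case: leqP.
apply: eq_card => r; rewrite in_setD /live !in_set ltnS.
apply/imsetP/andP => [[[r1 c]] | [/negP not_live le_rq]].
  rewrite inE /isB => /eqP Trc /= ->.
  have le_rq : (r1 <= q)%N.
    rewrite -ltnS; apply: leq_trans le_hq; rewrite lt_height // lt0n.
    by apply/eqP => lam0; move: Trc; rewrite out // lam0.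
  split=> //; rewrite le_rq; apply/negP => /forallP/(_ c).
  by rewrite Trc.
move: not_live; rewrite le_rq /= => /negP; rewrite negb_forall => /existsP[c].
by rewrite negbK => Trc; exists (r, c); rewrite ?inE.
Qed.


(** On the right [a] is coerced to 1 or 0, according to whether it is [Some]. *)
Lemma card_new_alpha (D : {set 'I_k}) (a : option 'I_k) : in_column D a ->
  #|[set r | isA (new_column D a r)]| = a.
Proof.
rewrite /new_column /isA; case: a => [s /= sD|_] /=.
  rewrite -(cards1 s); apply: eq_card => r; rewrite !inE.
  case: ifP => [rD | rND]; last by apply/esym/eqP => eq_rs; rewrite eq_rs sD in rND.
  by rewrite -val_eqE /=; case: ltngtP.
by apply: eq_card0 => r; rewrite !inE; case: ifP.
Qed.

Lemma card_new_beta (D : {set 'I_k}) (a : option 'I_k) : in_column D a ->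
  #|[set r | isB (new_column D a r)]| =
    if a is Some s then #|[set r in D | (s < r)%N]| else #|D|.
Proof.
rewrite /new_column /isB; case: a => [s /= sD|_] /=; apply: eq_card => r.
  by rewrite !inE; case: ifP => //= rD; rewrite -val_eqE /=; case: ltngtP.
by rewrite !inE; case: ifP.
Qed.

Lemma num_add_column w (y : shape w * filling k w * ('I_k * option 'I_k))
    (D := live y.2.1 y.1.2) (a := y.2.2) : addable y ->
  num_alpha (add_column y).2 = (num_alpha y.1.2 + a)%N /\
  num_beta (add_column y).2 =
    (num_beta y.1.2 + if a is Some s then #|[set r in D | (s < r)%N]| else #|D|)%N.
Proof.
rewrite {}/D {}/a; case: y => -[lam T] [q a] /and3P[_ _ aD].
rewrite /num_alpha /num_beta !card_add_column /= -(card_new_beta aD).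
rewrite -(card_new_alpha aD) !(addnC _ #|[set r | _ (new_column _ _ _)]|).
split; congr (_ + _)%N; apply: eq_card => -[r c]; rewrite !inE ffunE /=;
  by rewrite ?unlift_none ?liftK.
Qed.

(** * Summation over tableaux, by induction on the width *)

Variable R : numFieldType.

Definition cct_sum w (g : nat -> nat -> nat -> R) : R :=
  \sum_(x : shape w * filling k w | full_cct x)
     g (height x.1) (num_alpha x.2) (num_beta x.2).

Lemma sum_option (I : finType) (P : pred (option I)) (F : option I -> R) :
  P None -> \sum_(a | P a) F a = \sum_(i | P (Some i)) F (Some i) + F None.
Proof.
move=> PN; rewrite (bigD1 None) //= addrC; congr (_ + _).
case: (pickP (@predT I)) => [i0 _ | I0]; last first.
  by rewrite !big_pred0 // => [i|[i|]]; rewrite ?andbF //; have := I0 i.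
rewrite (reindex_onto Some (odflt i0)) => [|[i|]] /=; rewrite ?andbF //.
by apply: eq_bigl => i; rewrite eqxx !andbT.
Qed.

Lemma cct_sumS w g : cct_sum w.+1 g = cct_sum w (column_step k g).
Proof.
rewrite /cct_sum (reindex_onto (@add_column w) (@del_column w)); last first.
  by move=> x /del_columnP[].
(* Full tableaux of width [w.+1] correspond to [addable] data, and the sum splits into tableau,
   height of the new column and position of its alpha. *)
transitivity (\sum_(x : shape w * filling k w | full_cct x)
    \sum_(q : 'I_k | (height x.1 <= q.+1)%N)
    \sum_(a | in_column (live q x.2) a)
       let y := add_column (x, (q, a)) in
       g (height y.1) (num_alpha y.2) (num_beta y.2)).
  under [RHS]eq_bigr => x _ do rewrite pair_big_dep.
  rewrite pair_big_dep; apply: eq_big => [y | [x [q a]] _ //].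
  transitivity (addable y); last by case: y => [x [q a]].
  by apply/andP/idP => [[/del_columnP[yP _] /eqP <-] // | /add_columnP[-> -> _]].
apply: eq_bigr => -[lam T] Px; rewrite /column_step; apply: eq_bigr => q le_hq.
have addP a : in_column (live q T) a -> addable (lam, T, (q, a)).
  by move=> aD; apply/and3P.
have cardD := card_live (proj2 (andP Px)) le_hq.
(* Without alpha all live rows receive a beta, and [card_live] gives the total [q.+1]. *)
rewrite sum_option //; congr (_ + _); last first.
  have [|_ _ ->] := add_columnP (y := (lam, T, (q, None))); first exact: addP.
  have [|-> ->] := num_add_column (y := (lam, T, (q, None))); first exact: addP.
  by rewrite addn0 addnC cardD.
rewrite (eq_bigr (fun r => g q.+1 (num_alpha T).+1
    (num_beta T + #|[set i in live q T | (r < i)%N]|)%N)); last first.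
  move=> r rD.
  have [|_ _ ->] := add_columnP (y := (lam, T, (q, Some r))); first exact: addP.
  have [|-> ->] := num_add_column (y := (lam, T, (q, Some r))); first exact: addP.
  by rewrite addn1.
(* The new number of betas is [num_beta T + i] with [i] below the number of live rows; by
   [card_live] it runs from [num_beta T] to [q]. *)
rewrite (sum_card_above _ (fun i => g q.+1 (num_alpha T).+1 (num_beta T + i)%N)).
rewrite -(big_geq_mkord _ _ xpredT (fun i => g q.+1 (num_alpha T).+1 i)) /=.
rewrite -{2}[num_beta T]add0n big_addn -cardD addnK big_mkord.
by apply: eq_bigr => i _; rewrite [X in g _ _ X]addnC.
Qed.

Lemma cct_sum0 g : cct_sum 0 g = g 0 0 0.
Proof.
pose x0 : shape 0 * filling k 0 := ([ffun=> ord0], [ffun=> None]).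
have all_x0 x : x = x0.
  case: x => lam T; congr (_, _); apply/ffunP; last by move=> [r []].
  by move=> r; rewrite ffunE; apply: ord1.
have Px0 : full_cct x0.
  apply/andP; split; first by apply/forallP => r; rewrite ffunE eqxx implybT.
  by apply/cctP; split=> [r1 r2|r []|r []|r r' []|r []] //; rewrite !ffunE.
rewrite /cct_sum (big_pred1 x0) => [|x]; last by rewrite (all_x0 x) Px0 /= eqxx.
have -> : height x0.1 = 0%N.
  by apply: eq_card0 => r; rewrite !inE ffunE.
have -> : num_alpha x0.2 = 0%N by apply: eq_card0 => x; rewrite !inE ffunE.
by have -> : num_beta x0.2 = 0%N by apply: eq_card0 => x; rewrite !inE ffunE.
Qed.

Lemma cct_sumE u g : cct_sum u.+1 g = ccoef_sum u k g.
Proof.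
elim: u g => [|u IHu] g; last by rewrite cct_sumS IHu ccoef_sum_step.
by rewrite cct_sumS cct_sum0 column_step0.
Qed.

End Tableaux.

(** * Restriction to tableaux with all rows nonempty *)

Theorem theorem6p1 (R : numFieldType) (m k : nat) (al be : R) :
  (1 <= m)%N -> (1 <= k)%N ->
  Nprime m k al be =
  al ^+ k * be ^+ m *
  \sum_(l < k.+1) \sum_(j < m.+1)
    al ^+ j * be ^+ l *
    (binz R ((m + l)%:Z - 2 + kdelta j m) m.-1 *
       binz R ((k + j)%:Z - 2 + kdelta l k) k.-1
     - binz R ((m + l)%:Z - 2 + kdelta j m) m *
       binz R ((k + j)%:Z - 2 + kdelta l k) k).
Proof.
case: m k => [//|u] [//|n] _ _.
(* This test function keeps only the height [n.+1], which for a partition means that the last row is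
   nonempty. *)
pose g p a b : R := if p == n.+1 then al ^+ a * be ^+ b else 0.
transitivity (al ^+ n.+1 * be ^+ u.+1 * cct_sum n u.+1 g).
  rewrite /Nprime pair_big_dep /= /cct_sum /g mulr_sumr.
  under [RHS]eq_bigr => x _ do rewrite (fun_if ( *%R _)) mulr0.
  rewrite -big_mkcondr /=; apply: eq_big => [[lam T]|x _] /=; last first.
    by rewrite /wt !exprD; ring.
  rewrite /full_cct /shapeN' /= -andbA -[RHS]andbA; congr (_ && _).
  rewrite andbC; case: cctP => [[part _ _ _ _] /=|//].
  have ht_last := lt_height ord_max part.
  apply/forallP/eqP => [last_gt0 | htE r]; last first.
    by apply/implyP => /eqP r_n; rewrite -lt_height // htE.
  apply/eqP; rewrite eqn_leq height_le ht_last.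
  by have /implyP := last_gt0 ord_max; apply.
rewrite cct_sumE /ccoef_sum (bigD1 ord_max) //= [X in _ + X]big1 ?addr0; last first.
  move=> q neq_qn; apply: big1 => j _; apply: big1 => l _.
  rewrite /g eqSS (_ : (q : nat) == n = false) ?mulr0 //.
  by apply: contraNF neq_qn => /eqP q_n; apply/eqP/val_inj.
congr (_ * _); rewrite exchange_big; apply: eq_bigr => l _.
apply: eq_bigr => j _; rewrite /g eqxx mulrC; congr (_ * _).
(* With [m = u.+1] and [k = n.+1], the upper indices of the statement become those of [pbin], the
   deltas being booleans read as numbers. *)
have argE a b (c : bool) : (a.+1 + b)%:Z - 2 + (if c then 1 else 0) =
    (a + b + c)%:Z - 1 by case: c; lia.
by rewrite /kdelta !argE.
Qed.
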